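(* Let $E$ be a homogeneous effect algebra having the maximality property. Then $E$ can be covered by MV-algebras which form blocks; that is, $E$ is the union of its blocks, and every block of $E$ is an MV-algebra.
   Context: An effect algebra is a partial algebra $(E;\oplus,0,1)$ with $0\neq 1$ and a partial binary operation $\oplus$ such that for all $x,y,z\in E$: (1) $x\oplus y=y\oplus x$ if $x\oplus y$ is defined; (2) $(x\oplus y)\oplus z=x\oplus(y\oplus z)$ if one side is defined; (3) for every $x$ there is a unique $y$ (denoted $x'$) with $x\oplus y=1$; (4) if $1\oplus x$ is defined then $x=0$. One writes $x\le y$ and $y\ominus x=z$ iff $x\oplus z$ is defined and equals $y$; $\le$ is a partial order. A sub-effect algebra of $E$ is a subset $Q\subseteq E$ with $1\in Q$ such that whenever $x\oplus y=z$ in $E$ and two of $x,y,z$ lie in $Q$, all three lie in $Q$; it is an effect algebra with the inherited operation. $E$ satisfies the Riesz decomposition property if $u\le v_1\oplus v_2$ implies $u=u_1\oplus u_2$ for some $u_1\le v_1$, $u_2\le v_2$. $E$ is homogeneous if $u\le v_1\oplus v_2\le u'$ implies $u=u_1\oplus u_2$ for some $u_1\le v_1$, $u_2\le v_2$. A block of a homogeneous effect algebra $E$ is a maximal sub-effect algebra of $E$ with the Riesz decomposition property. $E$ has the maximality property if for every $u,v\in E$ the set $\{u,v\}$ has a maximal lower bound. An effect algebra is said to be an MV-algebra (an MV-effect algebra) if it is lattice ordered and has the Riesz decomposition property; it is then an MV-algebra under the total operation $x\boxplus y=x\oplus(x'\wedge y)$ and negation $x\mapsto x'$. *)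

(* Defs.v *)
From mathcomp Require Import all_boot.
From mathcomp Require Import boolp classical_sets.

Set Implicit Arguments.
Unset Strict Implicit.
Unset Printing Implicit Defensive.

Local Open Scope classical_set_scope.

(* The partial operation is option-valued, [None] meaning "undefined"; an
   equality between two options is then "if one side is defined, so is the
   other, and they are equal". *)
Record effectAlg : Type := EffectAlg {
  ea_sort :> Type;
  oplus : ea_sort -> ea_sort -> option ea_sort;
  ea0 : ea_sort;
  ea1 : ea_sort;
  orth : ea_sort -> ea_sort;
  ea0_neq1 : ea0 <> ea1;
  oplusC : forall x y, oplus x y = oplus y x;
  oplusA : forall x y z,
    obind (fun s => oplus s z) (oplus x y) =
    obind (fun t => oplus x t) (oplus y z);
  (* existence and uniqueness of the orthosupplement *)
  orthP : forall x y, oplus x y = Some ea1 <-> y = orth x;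
  oplus1_eq0 : forall x, oplus ea1 x <> None -> x = ea0
}.

Arguments oplus {e} x y.
Arguments ea0 {e}.
Arguments ea1 {e}.
Arguments orth {e} x.

Definition ea_le (E : effectAlg) (x y : E) : Prop :=
  exists z : E, oplus x z = Some y.

Definition riesz_decomposition (E : effectAlg) : Prop :=
  forall u v1 v2 v : E, oplus v1 v2 = Some v -> ea_le u v ->
  exists u1 u2 : E, [/\ ea_le u1 v1, ea_le u2 v2 & oplus u1 u2 = Some u].

Definition homogeneous (E : effectAlg) : Prop :=
  forall u v1 v2 v : E, oplus v1 v2 = Some v ->
  ea_le u v -> ea_le v (orth u) ->
  exists u1 u2 : E, [/\ ea_le u1 v1, ea_le u2 v2 & oplus u1 u2 = Some u].

Definition lower_bound2 (E : effectAlg) (u v w : E) : Prop :=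
  ea_le w u /\ ea_le w v.

Definition upper_bound2 (E : effectAlg) (u v w : E) : Prop :=
  ea_le u w /\ ea_le v w.

Definition maximality_property (E : effectAlg) : Prop :=
  forall u v : E, exists w : E, lower_bound2 u v w /\
    (forall t : E, lower_bound2 u v t -> ea_le w t -> t = w).

Definition lattice_ordered (E : effectAlg) : Prop :=
  forall u v : E,
    (exists m : E, lower_bound2 u v m /\
       (forall t : E, lower_bound2 u v t -> ea_le t m)) /\
    (exists j : E, upper_bound2 u v j /\
       (forall t : E, upper_bound2 u v t -> ea_le j t)).

Definition MV_effect_algebra (E : effectAlg) : Prop :=
  lattice_ordered E /\ riesz_decomposition E.

Record subEffectAlg (E : effectAlg) : Type := SubEffectAlg {
  sub_set :> set E;
  sub1 : sub_set ea1;
  (* [x (+) y = z] and any two of x, y, z in the set imply that the third is *)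
  sub_sum : forall x y z : E, oplus x y = Some z ->
    sub_set x -> sub_set y -> sub_set z;
  sub_diffl : forall x y z : E, oplus x y = Some z ->
    sub_set x -> sub_set z -> sub_set y;
  sub_diffr : forall x y z : E, oplus x y = Some z ->
    sub_set y -> sub_set z -> sub_set x
}.

Section SubEffectAlgebra.
Variables (E : effectAlg) (Q : subEffectAlg E).

Let T : Type := {x : E | sub_set Q x}.

Definition sub_oplus (x y : T) : option T :=
  match oplus (sval x) (sval y) as o
    return oplus (sval x) (sval y) = o -> option T with
  | Some z => fun e => Some (exist _ z (sub_sum e (svalP x) (svalP y)))
  | None => fun _ => None
  end erefl.

Lemma sub_val_inj (x y : T) : sval x = sval y -> x = y.
Proof.
case: x y => [x Qx] [y Qy] /= exy; case: y / exy Qy => Qy.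
by rewrite (Prop_irrelevance Qx Qy).
Qed.

Lemma sub_oplusE (x y : T) :
  omap sval (sub_oplus x y) = oplus (sval x) (sval y).
Proof.
rewrite /sub_oplus.
have FE o (e : oplus (sval x) (sval y) = o) :
  omap sval (match o as o0
    return oplus (sval x) (sval y) = o0 -> option T with
  | Some z => fun e => Some (exist _ z (sub_sum e (svalP x) (svalP y)))
  | None => fun _ => None
  end e) = o by case: o e.
exact: FE.
Qed.

Lemma sub_omap_inj (a b : option T) : omap sval a = omap sval b -> a = b.
Proof. by case: a b => [a|] [b|] //= [] /sub_val_inj ->. Qed.

Lemma ea1_orth : orth (ea1 : E) = ea0.
Proof.
by apply: oplus1_eq0; have /orthP -> := erefl (orth (ea1 : E)).
Qed.

Lemma sub_orth (x : E) : sub_set Q x -> sub_set Q (orth x).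
Proof.
move=> Qx; have /orthP e := erefl (orth x).
exact: sub_diffl e Qx (sub1 Q).
Qed.

Lemma sub0 : sub_set Q ea0.
Proof. by rewrite -ea1_orth; apply/sub_orth/sub1. Qed.

Let zero : T := exist _ ea0 sub0.
Let one : T := exist _ ea1 (sub1 Q).
Let sorth (x : T) : T := exist _ (orth (sval x)) (sub_orth (svalP x)).

Lemma sub_0_neq1 : zero <> one.
Proof. by move/(congr1 sval) => /= /(@ea0_neq1 E). Qed.

Lemma sub_oplusC (x y : T) : sub_oplus x y = sub_oplus y x.
Proof. by apply: sub_omap_inj; rewrite !sub_oplusE oplusC. Qed.

Lemma sub_oplusA (x y z : T) :
  obind (fun s => sub_oplus s z) (sub_oplus x y) =
  obind (fun t => sub_oplus x t) (sub_oplus y z).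
Proof.
apply: sub_omap_inj.
have -> : omap sval (obind (fun s => sub_oplus s z) (sub_oplus x y)) =
  obind (fun s => oplus s (sval z)) (oplus (sval x) (sval y)).
  by rewrite -sub_oplusE; case: sub_oplus => //= s; rewrite sub_oplusE.
rewrite oplusA -(sub_oplusE y z).
by case: (sub_oplus y z) => //= t; rewrite sub_oplusE.
Qed.

Lemma sub_orthP (x y : T) : sub_oplus x y = Some one <-> y = sorth x.
Proof.
split=> [/(congr1 (omap sval)) | ->].
  by rewrite sub_oplusE => /orthP e; apply: sub_val_inj.
by apply: sub_omap_inj; rewrite sub_oplusE; apply/orthP.
Qed.

Lemma sub_oplus1_eq0 (x : T) : sub_oplus one x <> None -> x = zero.
Proof.
move=> h; apply: sub_val_inj; apply: oplus1_eq0.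
by rewrite -[ea1]/(sval one) -sub_oplusE; case: sub_oplus h.
Qed.

Definition sub_effectAlg : effectAlg :=
  EffectAlg sub_0_neq1 sub_oplusC sub_oplusA sub_orthP sub_oplus1_eq0.

End SubEffectAlgebra.

Definition block (E : effectAlg) (B : subEffectAlg E) : Prop :=
  riesz_decomposition (sub_effectAlg B) /\
  (forall C : subEffectAlg E, riesz_decomposition (sub_effectAlg C) ->
     sub_set B `<=` sub_set C -> sub_set C = sub_set B).

(* Main.v *)
(* In a homogeneous effect algebra the blocks are the maximal internally
   compatible sets M: those in which every finite family consists of subsums of
   one finite family in M with sum 1. Zorn's lemma puts each pair {x, x'} in such
   an M. Homogeneity lets one refine a family with sum 1 so that it also sums to
   any u <= a <= u' with a in M, which makes the set of all elements reached this
   way again internally compatible; a maximal M therefore contains them all, and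
   is closed under (+) and ' and inherits Riesz decomposition.
   For the lattice property write u = c (+) a and v = c (+) b in a block, where
   a <= b'. A maximal lower bound w of a and b in E satisfies w <= a <= w', so it
   lies in the block, and c (+) w is the meet of u and v there. *)
From HB Require Import structures.
Require Import Defs.
From mathcomp Require Import all_boot.
From mathcomp Require Import boolp classical_sets.

Set Implicit Arguments.
Unset Strict Implicit.
Unset Printing Implicit Defensive.

Local Open Scope classical_set_scope.

Section InternalCompatibility.
Variable E : effectAlg.
Implicit Types x y z t u v w : E.

(** * Arithmetic and order in an effect algebra *)

Lemma oplus_orth x : oplus x (orth x) = Some ea1.
Proof. exact/orthP. Qed.

Lemma orthK x : orth (orth x) = x.
Proof. by symmetry; apply/orthP; rewrite oplusC oplus_orth. Qed.

Lemma orth1 : orth ea1 = ea0 :> E.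
Proof. exact: ea1_orth. Qed.

Lemma oplusx0 x : oplus x ea0 = Some x.
Proof.
have := oplusA (orth x) x ea0.
rewrite (oplusC (orth x)) oplus_orth /= -orth1 oplus_orth.
by case: oplus => //= t /esym/orthP ->; rewrite orthK.
Qed.

Lemma oplus0x x : oplus ea0 x = Some x.
Proof. by rewrite oplusC oplusx0. Qed.

(** The partial sum made total, with [None] absorbing. This is a commutative monoid, so the big
    operators apply. *)
Definition oadd (a b : option E) : option E :=
  obind (fun x => obind (oplus x) b) a.

Lemma oaddA : associative oadd.
Proof.
move=> [x|] [y|] [z|] //=; last by case: (oplus x y).
by have := oplusA x y z; case: (oplus x y) => //=; case: (oplus y z).
Qed.

Lemma oaddC : commutative oadd.
Proof. by case=> [x|] [y|] //=; rewrite oplusC. Qed.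

Lemma oadd0 : left_id (Some ea0) oadd.
Proof. by case=> [x|] //=; rewrite oplus0x. Qed.

HB.instance Definition _ :=
  Monoid.isComLaw.Build (option E) (Some ea0) oadd oaddA oaddC oadd0.

Lemma oadd_Some a b z : oadd a b = Some z ->
  exists x y, [/\ a = Some x, b = Some y & oplus x y = Some z].
Proof. by case: a b => [x|] [y|] //= e; exists x, y. Qed.

Lemma oaddE x y : oadd (Some x) (Some y) = oplus x y.
Proof. by []. Qed.

Arguments oadd : simpl never.

Lemma oplus_assoc x y z t s : oplus x y = Some t -> oplus t z = Some s ->
  exists2 r, oplus y z = Some r & oplus x r = Some s.
Proof.
move=> e1 e2; have := oplusA x y z; rewrite e1 /= e2.
by case: oplus => //= r e3; exists r.
Qed.

(** Both [y] and [z] are the orthosupplement of [x (+) t']. *)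
Lemma oplusI x y z t : oplus x y = Some t -> oplus x z = Some t -> y = z.
Proof.
move=> ey ez; have e1 := oplus_orth t.
rewrite oplusC in ey; rewrite oplusC in ez.
have [r er /esym] := oplus_assoc ey e1.
have [r' er' /esym] := oplus_assoc ez e1.
move: er'; rewrite er => -[<-].
rewrite [in X in X -> _]oplusC [in X in _ -> X -> _]oplusC.
by move=> /esym/orthP -> /esym/orthP ->.
Qed.

(** Reassociating [0 (+) 1] makes [y (+) 1] defined, so [y = 0]. *)
Lemma oplus_eq0 x y : oplus x y = Some ea0 -> x = ea0.
Proof.
move=> e; have [r er _] := oplus_assoc e (oplus0x ea1).
have y0 : y = ea0 by apply: oplus1_eq0; rewrite oplusC er.
by move: e; rewrite y0 oplusx0 => -[].
Qed.

Lemma le1 x : ea_le x ea1.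
Proof. by exists (orth x); rewrite oplus_orth. Qed.

Lemma le_trans y x z : ea_le x y -> ea_le y z -> ea_le x z.
Proof. by move=> [a ea] [b eb]; have [r _ er] := oplus_assoc ea eb; exists r. Qed.

Lemma le_oplusl x y z : oplus x y = Some z -> ea_le x z.
Proof. by exists y. Qed.

Lemma le_oplusr x y z : oplus x y = Some z -> ea_le y z.
Proof. by exists x; rewrite oplusC. Qed.

Lemma le_orthP x y : ea_le x (orth y) <-> exists z, oplus x y = Some z.
Proof.
split=> [[a ea]|[z ez]].
  have e1 : oplus (orth y) y = Some ea1 by rewrite oplusC oplus_orth.
  rewrite oplusC in ea.
  by have [r er _] := oplus_assoc ea e1; exists r.
rewrite oplusC in ez.
have [r er er1] := oplus_assoc ez (oplus_orth z).
by move/orthP: er1 => <-; exists (orth z).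
Qed.

Lemma le_orthC x y : ea_le x (orth y) -> ea_le y (orth x).
Proof. by move/le_orthP => [z ez]; apply/le_orthP; exists z; rewrite oplusC. Qed.

Lemma le_orth2 x y : ea_le x y -> ea_le (orth y) (orth x).
Proof. by move=> le; apply: le_orthC; rewrite orthK. Qed.

Lemma le_oplus2l x y z t s : oplus x y = Some t -> oplus x z = Some s ->
  ea_le t s -> ea_le y z.
Proof.
move=> et es [r er]; have [q eq eq'] := oplus_assoc et er.
by exists r; rewrite eq (oplusI eq' es).
Qed.

(** * Sums of finite families and their refinements *)

(* [osum P f] is [None] exactly when the subfamily is not orthogonal. *)
Definition osum (I : finType) (P : pred I) (f : I -> E) : option E :=
  \big[oadd/Some ea0]_(i | P i) Some (f i).

Lemma osumID (I : finType) (Q P : pred I) (f : I -> E) :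
  osum P f = oadd (osum [pred i | P i && Q i] f)
                  (osum [pred i | P i && ~~ Q i] f).
Proof. exact: bigID. Qed.

Lemma eq_osum (I : finType) (P Q : pred I) (f : I -> E) :
  P =1 Q -> osum P f = osum Q f.
Proof. exact: eq_bigl. Qed.

Lemma osum_predC (I : finType) (f : I -> E) v (P : pred I) :
  osum predT f = Some v ->
  exists a b, [/\ osum P f = Some a, osum (predC P) f = Some b &
                 oplus a b = Some v].
Proof. by rewrite (osumID P) => /oadd_Some. Qed.

Lemma osum1 (I : finType) (i : I) (f : I -> E) : osum (pred1 i) f = Some (f i).
Proof. exact: big_pred1_eq. Qed.

Lemma le_osum (I : finType) (P : pred I) (f : I -> E) i v :
  P i -> osum P f = Some v -> ea_le (f i) v.
Proof.
move=> Pi; rewrite /osum (bigD1 i) //= => /oadd_Some [x [y [[<-] _]]].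
exact: le_oplusl.
Qed.

(** Refines a family with members [w i (+) r i]; the index [true] marks the piece [w i]. *)
Definition split2 (I : finType) (w r : I -> E) (k : I * bool) : E :=
  if k.2 then w k.1 else r k.1.

Lemma osum_split2 (I : finType) (w r f : I -> E) (P : pred I) :
  (forall i, oplus (w i) (r i) = Some (f i)) ->
  osum [pred k | P k.1] (split2 w r) = osum P f.
Proof.
move=> h; rewrite /osum.
rewrite [RHS](eq_bigr (fun i =>
    \big[oadd/Some ea0]_(b : bool) Some (split2 w r (i, b)))); last first.
  by move=> i _; rewrite big_bool /= oaddE h.
rewrite pair_big_dep /=.
by apply: eq_big => [[i b]|[i b] _] //=; rewrite andbT.
Qed.

Lemma osum_split2l (I : finType) (w r : I -> E) (P : pred I) :
  osum [pred k | P k.1 && k.2] (split2 w r) = osum P w.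
Proof.
rewrite /osum.
rewrite [RHS](eq_bigr (fun i =>
    \big[oadd/Some ea0]_(b : bool | b) Some (split2 w r (i, b)))).
  by rewrite pair_big_dep /=; apply: eq_big => [[i b]|[i b] _].
by move=> i _; rewrite big_mkcond big_bool /= oaddE oplusx0.
Qed.

(* [D] is [True] under Riesz decomposition and [v <= u'] under homogeneity. *)
Lemma decomposition_osum (D : E -> E -> Prop)
    (D_le : forall u u' v v', ea_le u u' -> ea_le v v' -> D u' v' -> D u v)
    (D_dec : forall u v1 v2 v, oplus v1 v2 = Some v -> ea_le u v -> D u v ->
      exists u1 u2, [/\ ea_le u1 v1, ea_le u2 v2 & oplus u1 u2 = Some u])
    (I : finType) (f : I -> E) (P : pred I) u v :
  osum P f = Some v -> ea_le u v -> D u v ->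
  exists w r : I -> E,
    (forall i, oplus (w i) (r i) = Some (f i)) /\ osum P w = Some u.
Proof.
elim: {P}_.+1 {-2}P (ltnSn #|P|) u v => // n IHn P ltPn u v.
have [[i Pi]|P0] := pselect (exists i, P i); last first.
  have P0' : P =1 pred0 by move=> i; apply/negP => Pi; apply: P0; exists i.
  rewrite (eq_osum _ P0') /osum big_pred0_eq => -[<-] [z /oplus_eq0 ->] _.
  exists (fun=> ea0), f; split=> [i|]; first by rewrite oplus0x.
  by rewrite big_pred0.
(* [D_dec] divides [u] between one member and the sum of the others; [D_le] hands [D] down to the
   smaller pair for the induction. *)
rewrite /osum (bigD1 i) //= => /oadd_Some [x [y [[<-] ey exy]]] leuv Duv.
have [u1 [u2 [le1' le2' e12]]] := D_dec _ _ _ _ exy leuv Duv.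
have lt : (#|[pred j | P j && (j != i)]| < n)%N.
  rewrite ltnS (cardD1 i) unfold_in Pi add1n in ltPn.
  apply: leq_trans ltPn; rewrite ltnS; apply: subset_leq_card.
  by apply/fintype.subsetP => j; rewrite !inE andbC.
have [w [r [wr ew]]] := IHn _ lt u2 y ey le2'
  (D_le _ _ _ _ (le_oplusr e12) (le_oplusr exy) Duv).
have [q eq] := le1'.
exists (fun j => if j == i then u1 else w j),
       (fun j => if j == i then q else r j); split.
  by move=> j; case: eqP => [->|].
rewrite (bigD1 i) //= eqxx.
rewrite (eq_bigr (fun j => Some (w j))); last first.
  by move=> j /andP[_ /negPf ->].
by rewrite [X in oadd _ X]ew oaddE e12.
Qed.

Lemma homogeneous_osum (hE : homogeneous E) (I : finType) (f : I -> E)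
    (P : pred I) u v :
  osum P f = Some v -> ea_le u v -> ea_le v (orth u) ->
  exists w r : I -> E,
    (forall i, oplus (w i) (r i) = Some (f i)) /\ osum P w = Some u.
Proof.
move=> e le h.
apply: (decomposition_osum (D := fun u v => ea_le v (orth u))) e le h => //.
move=> {}u u' {}v v' leu lev h.
by apply: le_trans lev _; apply: le_trans h _; apply: le_orth2.
Qed.

Lemma riesz_osum (rE : riesz_decomposition E) (I : finType) (f : I -> E)
    (P : pred I) u v :
  osum P f = Some v -> ea_le u v ->
  exists w r : I -> E,
    (forall i, oplus (w i) (r i) = Some (f i)) /\ osum P w = Some u.
Proof.
move=> e le; apply: (decomposition_osum (D := fun _ _ => True)) e le _ => //.
by move=> {}u v1 v2 {}v e le _; apply: rE e le.
Qed.

(** * Internal compatibility and its extension *)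

Definition partition_of_unity (M : set E) (I : finType) (f : I -> E) : Prop :=
  (forall i, M (f i)) /\ osum predT f = Some ea1.

Definition subsum (I : finType) (f : I -> E) (z : E) : Prop :=
  exists P : pred I, osum P f = Some z.

Definition internally_compatible (M : set E) : Prop :=
  forall (J : finType) (F : J -> E), (forall j, M (F j)) ->
  exists (I : finType) (f : I -> E),
    partition_of_unity M f /\ forall j, subsum f (F j).

(** The one-step condition for enlarging a set: [r1] and [r2] are old elements from which [y] is
    reached. Old subsums must survive, so that steps can be iterated. *)
Definition adjoinable (L : set E) (r1 r2 y : E) : Prop :=
  forall (I : finType) (f : I -> E), partition_of_unity L f ->
    subsum f r1 -> subsum f r2 ->
  exists (I' : finType) (f' : I' -> E), [/\ partition_of_unity L f',
    (forall z, subsum f z -> subsum f' z) & subsum f' y].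

Lemma adjoinable_trans (L : set E) r1 r2 a b y :
  adjoinable L r1 r2 a -> adjoinable L r1 r2 b -> adjoinable L a b y ->
  adjoinable L r1 r2 y.
Proof.
move=> ha hb hy I f pf s1 s2.
have [I1 [f1 [pf1 sf1 sa]]] := ha I f pf s1 s2.
have [I2 [f2 [pf2 sf2 sb]]] := hb _ f1 pf1 (sf1 _ s1) (sf1 _ s2).
have [I3 [f3 [pf3 sf3 sy]]] := hy _ f2 pf2 (sf2 _ sa) sb.
by exists I3, f3; split=> // z /sf1/sf2/sf3.
Qed.

Lemma adjoinablel (L : set E) r1 r2 : adjoinable L r1 r2 r1.
Proof. by move=> I f pf s1 s2; exists I, f. Qed.

(** Start from a partition in [M] for all the elements [r1], [r2] attached to the family, then
    refine it for one member of the family after another. The refinements live in [L]. *)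
Lemma internally_compatible_extend (M L N : set E) :
  M `<=` L -> L `<=` N -> internally_compatible M ->
  (forall y, N y -> exists r1 r2, [/\ M r1, M r2 & adjoinable L r1 r2 y]) ->
  internally_compatible N.
Proof.
move=> ML LN icM ext J F NF.
have [r rP] : exists r : J -> E * E, forall j,
    [/\ M (r j).1, M (r j).2 & adjoinable L (r j).1 (r j).2 (F j)].
  suff /choice[r rP] : forall j, exists q : E * E,
    [/\ M q.1, M q.2 & adjoinable L q.1 q.2 (F j)] by exists r.
  move=> j; have [r1 [r2 h]] := ext _ (NF j); by exists (r1, r2).
have [j|I [f [[Mf f1] cf]]] := icM _
    (fun k : J * bool => if k.2 then (r k.1).1 else (r k.1).2).
  by have [] := rP j.1; case: (j.2).
have [I' [f' [[Lf' f'1] _ cf']]] : exists (I' : finType) (f' : I' -> E),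
    [/\ partition_of_unity L f', (forall z, subsum f z -> subsum f' z) &
        forall j, j \in enum J -> subsum f' (F j)].
  elim: (enum J) => [|j s [I' [f' [pf' ff' cf']]]].
    by exists I, f; split=> //; split=> // i; apply/ML/Mf.
  have [_ _ extr] := rP j; have [||I2 [f2 [pf2 ff2 yf2]]] := extr I' f' pf'.
  - exact/ff'/(cf (j, true)).
  - exact/ff'/(cf (j, false)).
  exists I2, f2; split=> // [z /ff'/ff2//|k].
  by rewrite in_cons => /orP[/eqP->//|/cf'/ff2].
exists I', f'; split; last by move=> j; apply: cf'; rewrite mem_enum.
by split=> // i; apply: LN.
Qed.

(** * Refining a partition of unity within a set *)

(** Covers exactly the pieces that homogeneity cuts off, so refined partitions stay in [M]. *)
Definition small_closed (M : set E) : Prop :=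
  forall a u v, M a -> oplus u v = Some a -> ea_le a (orth u) -> M u /\ M v.

Lemma subsum_split2 (I : finType) (w r f : I -> E) z :
  (forall i, oplus (w i) (r i) = Some (f i)) ->
  subsum f z -> subsum (split2 w r) z.
Proof.
by move=> wr [P e]; exists [pred k | P k.1]; rewrite (osum_split2 _ wr).
Qed.

(** For [i] in [P], [w i <= f i <= a <= u' <= (w i)'], so both pieces of [f i] lie in [M]. *)
Lemma split_below_small (hE : homogeneous E) (M : set E) (I : finType)
    (f : I -> E) (P : pred I) u a :
  small_closed M -> partition_of_unity M f ->
  osum P f = Some a -> ea_le u a -> ea_le a (orth u) ->
  exists w r : I -> E, [/\ forall i, oplus (w i) (r i) = Some (f i),
    osum P w = Some u & partition_of_unity M (split2 w r)].
Proof.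
move=> sM [Mf f1] ea lua lau.
have [w [r [wr ew]]] := homogeneous_osum hE ea lua lau.
(* Homogeneity controls the splitting only inside [P]; elsewhere [f i] is split trivially as
   [0 (+) f i]. *)
pose w' i := if P i then w i else ea0; pose r' i := if P i then r i else f i.
have wr' i : oplus (w' i) (r' i) = Some (f i).
  by rewrite /w' /r'; case: (P i); rewrite ?oplus0x.
have ew' : osum P w' = Some u.
  by rewrite -ew; apply: eq_bigr => i Pi; rewrite /w' Pi.
exists w', r'; split=> //; split; last by rewrite -f1 -(osum_split2 _ wr').
have M' i : M (w' i) /\ M (r' i).
  apply: sM (Mf i) (wr' i) _.
  case Pi : (P i); last by rewrite /w' Pi -orth1 orthK; apply: le1.
  apply: le_trans (le_osum Pi ea) _; apply: le_trans lau _.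
  exact/le_orth2/(le_osum Pi ew').
by move=> [i []]; have [] := M' i.
Qed.

(* With [p], [q] the parts of [u], [v] outside their common subfamily, cancelling
   the latter gives [p <= q <= p'], so [p] can be spread below [q]. *)
Lemma split_nested (hE : homogeneous E) (M : set E) (I : finType)
    (f : I -> E) (P V : pred I) u v :
  small_closed M -> partition_of_unity M f ->
  osum P f = Some u -> osum V f = Some v -> ea_le u v ->
  exists w r : I -> E, [/\ forall i, oplus (w i) (r i) = Some (f i),
    partition_of_unity M (split2 w r) &
    exists2 Q : pred (I * bool), (forall k, Q k -> V k.1) &
      osum Q (split2 w r) = Some u].
Proof.
move=> sM pf eu ev luv.
have := eu; rewrite (osumID V) => /oadd_Some[c [p [ec ep ecp]]].
have := ev; rewrite (osumID P) => /oadd_Some[c' [q [ec' eq ecq]]].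
have ? : c' = c.
  by apply: Some_inj; rewrite -ec -ec'; apply: eq_osum => i /=; rewrite andbC.
subst c'.
have lpq : ea_le p q := le_oplus2l ecp ecq luv.
(* [p] and [q] are sums over disjoint parts of one partition, so [p (+) q] is defined. *)
have [s [_ [es _ _]]] := osum_predC [pred i | P i (+) V i] (proj2 pf).
have {es} epq : oplus p q = Some s.
  rewrite -es (osumID P) -oaddE -ep -eq.
  congr oadd; apply: eq_osum => i /=; by case: (P i); case: (V i).
have lqp : ea_le q (orth p) by apply/le_orthP; exists s; rewrite oplusC.
have [w [r [wr ew pw]]] := split_below_small hE sM pf eq lpq lqp.
exists w, r; split=> //.
(* Both pieces over the common indices sum to [c]; the [true] pieces over [V] outside [P] sum to
   [p]. *)
exists [pred k | V k.1 && (P k.1 || k.2)]; first by move=> k /andP[].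
rewrite (osumID [pred k | P k.1]) -ecp -oaddE -ec' -ew.
rewrite -(osum_split2 _ wr) -(osum_split2l w r).
by congr oadd; apply: eq_osum => -[i []] /=; case: (P i); case: (V i).
Qed.

(** * Enlargements that preserve internal compatibility *)

(** If [P] selects [x], its complement selects [x']. *)
Lemma internally_compatible_orth (M : set E) : internally_compatible M ->
  internally_compatible (M `|` [set orth x | x in M]).
Proof.
move=> icM; apply: (internally_compatible_extend (L := M)) icM _ => //.
move=> y [My|[x Mx <-]]; first by exists y, y; split=> //; apply: adjoinablel.
exists x, x; split=> // I f pf s _; exists I, f; split=> //.
case: s => P eP; exists (predC P).
have [a [b [ea -> eab]]] := osum_predC P (proj2 pf).
by move: ea eab; rewrite eP => -[<-] /orthP ->.
Qed.

(** If [R] selects [y], its complement selects [y' >= x]. After refinement [x] is a subsum inside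
    that complement, hence disjoint from [R], and the union selects [x (+) y]. *)
Lemma internally_compatible_oplus (hE : homogeneous E) (M : set E) :
  small_closed M -> internally_compatible M ->
  internally_compatible (M `|`
    [set z | exists x y, [/\ M x, M y & oplus x y = Some z]]).
Proof.
move=> sM icM; apply: (internally_compatible_extend (L := M)) icM _ => //.
move=> z [Mz|[x [y [Mx My exy]]]]; first by exists z, z; split=> //; apply: adjoinablel.
exists x, y; split=> // I f pf [P eP] [R eR].
have [y' [v [ey' ev /orthP vE]]] := osum_predC R (proj2 pf).
move: ey' vE; rewrite eR => -[<-] vE; subst v.
have lxy : ea_le x (orth y) by apply/le_orthP; exists z.
have [w [r [wr pw [Q QR eQ]]]] := split_nested hE sM pf eP ev lxy.
exists _, (split2 w r); split=> //; first by move=> t; apply: subsum_split2.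
exists [pred k | Q k || R k.1].
rewrite (osumID Q) -exy -oaddE -eQ -eR -(osum_split2 _ wr).
congr oadd; apply: eq_osum => k /=.
  by case: (Q k); rewrite ?andbF.
by case: (boolP (Q k)) => [/QR /= /negPf->|_]; rewrite ?andbT.
Qed.

Inductive small_closure (M : set E) : set E :=
| small_closure_base a : M a -> small_closure M a
| small_closure_l a u v : small_closure M a -> oplus u v = Some a ->
    ea_le a (orth u) -> small_closure M u
| small_closure_r a u v : small_closure M a -> oplus u v = Some a ->
    ea_le a (orth u) -> small_closure M v.

Lemma small_closureP M : small_closed (small_closure M).
Proof.
by move=> a u v Ma e le; split;
  [apply: small_closure_l e le|apply: small_closure_r e le].
Qed.

(** Refining below [a] exhibits [u] as the sum of the [true] pieces and, by cancellation, [v] as the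
    sum of the others. Induction on the closure composes such steps. *)
Lemma internally_compatible_small_closure (hE : homogeneous E) (M : set E) :
  internally_compatible M -> internally_compatible (small_closure M).
Proof.
move=> icM; apply: (internally_compatible_extend (L := small_closure M)) icM _.
- exact: small_closure_base.
- by [].
have split_a a u v : oplus u v = Some a -> ea_le a (orth u) ->
    adjoinable (small_closure M) a a u /\ adjoinable (small_closure M) a a v.
  move=> e le.
  split=> I f pf [P eP] _; have [w [r [wr ew pw]]] :=
    split_below_small hE (@small_closureP M) pf eP (le_oplusl e) le;
  exists _, (split2 w r); split=> //; try by move=> t; apply: subsum_split2.
    by exists [pred k | P k.1 && k.2]; rewrite osum_split2l.
  exists [pred k | P k.1 && ~~ k.2].
  have := eP; rewrite -(osum_split2 _ wr) (osumID [pred k | k.2]).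
  move=> /oadd_Some[u' [v' [eu' -> e']]].
  move: eu'; rewrite osum_split2l ew => -[?]; subst u'.
  by rewrite (oplusI e' e).
move=> y cy; suff [r Mr h] : exists2 r, M r & adjoinable (small_closure M) r r y.
  by exists r, r.
elim: {y}cy => [a Ma|a u v _ [r Mr h] e le|a u v _ [r Mr h] e le];
  [by exists a => //; apply: adjoinablel|exists r => //..];
  apply: (adjoinable_trans h h); by have [] := split_a _ _ _ e le.
Qed.

(** * Maximal internally compatible sets *)

Definition maximal_internally_compatible (M : set E) : Prop :=
  internally_compatible M /\
  forall N, M `<=` N -> internally_compatible N -> N `<=` M.

Lemma maximal_internally_compatible_exists (Q : set E) :
  internally_compatible Q ->
  exists2 M, Q `<=` M & maximal_internally_compatible M.
Proof.
move=> icQ.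
(* Adjoining [Q] inside the property makes the maximal set contain [Q] and settles the empty
   chain. *)
have [F FP totF|A [icA maxA]] :=
  @Zorn_bigcup E (fun X => internally_compatible (X `|` Q)).
  move=> J f fM.
  have [[X0 FX0]|F0] := pselect (exists X, F X); last first.
    have [j|I [g [[Qg g1] cg]]] := icQ J f.
      by case: (fM j) => // -[X FX _]; case: F0; exists X.
    by exists I, g; split=> //; split=> // i; right.
  (* A finite family meets only finitely many members of the chain, so one member, together with
     [Q], contains it. *)
  have [X FX fX] : exists2 X, F X & forall j, j \in enum J -> (X `|` Q) (f j).
    elim: (enum J) => [|j s [X FX fX]]; first by exists X0.
    have [[Y FY Yf]|Qf] := fM j; last first.
      by exists X => // k; rewrite in_cons => /orP[/eqP->|/fX//]; right.
    have [XY|YX] := totF _ _ FX FY.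
      exists Y => // k; rewrite in_cons.
      by move=> /orP[/eqP->|/fX[/XY|]]; [left|left|right].
    by exists X => // k; rewrite in_cons => /orP[/eqP->|/fX//]; left; apply: YX.
  have [j|I [g [[Qg g1] cg]]] := FP _ FX J f; first by apply: fX; rewrite mem_enum.
  exists I, g; split=> //; split=> // i.
  by case: (Qg i) => [Xg|]; [left; exists X|right].
exists (A `|` Q); first by move=> x Qx; right.
split=> // N AN icN x Nx; left.
apply: contrapT => Ax; apply: (maxA N).
  by split=> [y Ay|NA]; [apply: AN; left|apply/Ax/NA].
suff -> : N `|` Q = N by [].
by apply/seteqP; split=> [y [//|Qy]|y]; [apply: AN; right|left].
Qed.

Lemma maximal_small_closed (hE : homogeneous E) M :
  maximal_internally_compatible M -> small_closed M.
Proof.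
move=> [icM maxM].
have cM : small_closure M `<=` M.
  apply: maxM; first exact: small_closure_base.
  exact: internally_compatible_small_closure.
move=> a u v /small_closure_base Ma e le.
by have [/cM ? /cM ?] := small_closureP Ma e le.
Qed.

Lemma maximal_orth M x : maximal_internally_compatible M -> M x -> M (orth x).
Proof.
move=> [icM maxM] Mx; apply: (maxM _ _ (internally_compatible_orth icM)).
  by move=> y My; left.
by right; exists x.
Qed.

Lemma maximal_oplus (hE : homogeneous E) M x y z :
  maximal_internally_compatible M -> M x -> M y -> oplus x y = Some z -> M z.
Proof.
move=> maxM Mx My e; have sM := maximal_small_closed hE maxM.
case: maxM => icM maxM.
apply: (maxM _ _ (internally_compatible_oplus hE sM icM)).
  by move=> t Mt; left.
by right; exists x, y.
Qed.

(** Here [y = (x (+) z')']. *)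
Lemma maximal_diffl (hE : homogeneous E) M x y z :
  maximal_internally_compatible M -> M x -> M z -> oplus x y = Some z -> M y.
Proof.
move=> maxM Mx Mz; rewrite oplusC => e.
have [r er er1] := oplus_assoc e (oplus_orth z).
rewrite oplusC in er1; move/orthP: er1 => ->; apply: (maximal_orth maxM).
exact: maximal_oplus maxM Mx (maximal_orth maxM Mz) er.
Qed.

Lemma maximal1 (hE : homogeneous E) M :
  maximal_internally_compatible M -> M ea1.
Proof.
move=> maxM; case: (maxM) => icM _.
(* The empty family still yields a partition in [M]. Its index type is inhabited, as an empty sum
   would give [0 = 1], and any member plus its orthosupplement is [1]. *)
have [[]|I [f [[Mf f1] _]]] := icM void (fun v : void => match v with end).
have [[i _]|I0] := pselect (exists i : I, true).
  exact: maximal_oplus maxM (Mf i) (maximal_orth maxM (Mf i)) (oplus_orth _).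
have I0' : predT =1 @pred0 I by move=> i; case: I0; exists i.
by move: f1; rewrite (eq_osum _ I0') /osum big_pred0_eq => -[/ea0_neq1].
Qed.

Lemma maximal_osum (hE : homogeneous E) M (I : finType) (f : I -> E) P z :
  maximal_internally_compatible M -> (forall i, M (f i)) ->
  osum P f = Some z -> M z.
Proof.
move=> maxM Mf; rewrite /osum; elim/big_ind: _ z => [z [<-]|a b ha hb z|i _ z [<-]//].
  by rewrite -orth1; apply: (maximal_orth maxM); apply: maximal1 maxM.
by move=> /oadd_Some[x [y [/ha Mx /hb My e]]]; apply: (maximal_oplus hE maxM Mx My e).
Qed.

(** Two refinements place [u] and [v1] on index sets [Q] and [Q'] inside the one selecting [v]. By
    cancellation [v2] is selected by the rest of that set outside [Q']; cutting [Q] along [Q'] gives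
    [u1] and [u2]. *)
Lemma maximal_riesz (hE : homogeneous E) M u v1 v2 v :
  maximal_internally_compatible M -> M u -> M v1 -> M v2 ->
  oplus v1 v2 = Some v -> ea_le u v ->
  exists u1 u2, [/\ M u1 /\ M u2, ea_le u1 v1, ea_le u2 v2 &
                    oplus u1 u2 = Some u].
Proof.
move=> maxM Mu Mv1 Mv2 ev luv; have sM := maximal_small_closed hE maxM.
have Mv := maximal_oplus hE maxM Mv1 Mv2 ev.
have [[[|]|]//|I [f [pf sf]]] := (proj1 maxM) _ (fun k : option bool =>
  match k with None => u | Some true => v1 | Some false => v end).
have [P eP] := sf None; have [R eR] := sf (Some true).
have {sf} [V eV] := sf (Some false).
have [w [r [wr pg [Q QV eQ]]]] := split_nested hE sM pf eP eV luv.
rewrite -(osum_split2 _ wr) in eR; rewrite -(osum_split2 _ wr) in eV.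
set g := split2 w r in pg eQ eR eV.
have [w' [r' [wr' ph [Q' QV' eQ']]]] :=
  split_nested hE sM pg eR eV (le_oplusl ev).
rewrite -(osum_split2 _ wr') in eQ; rewrite -(osum_split2 _ wr') in eV.
set h := split2 w' r' in ph eQ eQ' eV.
have := eQ; rewrite (osumID Q') => /oadd_Some[u1 [u2 [eu1 eu2 eu]]].
exists u1, u2; split=> //.
- by split; [move: eu1|move: eu2]; apply: (maximal_osum hE maxM); case: ph.
- have := eQ'; rewrite (osumID [pred k | Q k.1]) => /oadd_Some[a [b [ea _]]].
  suff -> : a = u1 by exact: le_oplusl.
  by apply: Some_inj; rewrite -ea -eu1; apply: eq_osum => k /=; rewrite andbC.
have := eV; rewrite (osumID Q') => /oadd_Some[a [b [ea eb eab]]].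
have av1 : a = v1.
  apply: Some_inj; rewrite -ea -eQ'; apply: eq_osum => k /=.
  by case: (boolP (Q' k)) => [/QV' /= ->|]; rewrite ?andbF.
have bv2 : b = v2 by apply: oplusI ev; rewrite -av1.
rewrite -{}bv2; have := eb.
rewrite (osumID [pred k | Q k.1]) => /oadd_Some[c [d [ec _]]].
suff -> : c = u2 by exact: le_oplusl.
apply: Some_inj; rewrite -ec -eu2; apply: eq_osum => k /=.
by case: (boolP (Q k.1)) => [/QV /= ->|_]; rewrite ?andbT ?andbF.
Qed.

(** * Basic internally compatible sets *)

Lemma internally_compatible1 : internally_compatible [set ea1].
Proof.
have sum1 : osum predT (fun _ : unit => ea1 : E) = Some ea1.
  by rewrite -(osum1 tt (fun=> ea1)); apply: eq_osum => -[].
move=> J F F1; exists unit, (fun=> ea1); split=> [//|j].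
by exists predT; rewrite F1.
Qed.

Lemma internally_compatible_pair x : internally_compatible [set x; orth x].
Proof.
pose f (b : bool) := if b then x else orth x.
move=> J F FM; exists bool, f; split=> [|j].
  split; first by case; [left|right].
  by rewrite /osum big_bool /= oaddE oplus_orth.
by case: (FM j) => ->; [exists (pred1 true)|exists (pred1 false)]; rewrite osum1.
Qed.

(** Every [y] lies below the total [1] of any partition of unity, so Riesz decomposition refines the
    partition to reach [y]; the set [{1}] is the starting point. *)
Lemma riesz_internally_compatible :
  riesz_decomposition E -> internally_compatible [set: E].
Proof.
move=> rE.
apply: (internally_compatible_extend (L := setT)) internally_compatible1 _ => //.
move=> y _; exists ea1, ea1; split=> // I f [_ f1] _ _.
have [w [r [wr ew]]] := riesz_osum rE f1 (le1 y).
exists _, (split2 w r); split; last by exists [pred k | predT k.1 && k.2];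
  rewrite osum_split2l.
- by split=> //; rewrite -f1 -(osum_split2 _ wr).
- by move=> t; apply: subsum_split2.
Qed.

End InternalCompatibility.

(** * Transfer between a sub-effect algebra and its ambient algebra *)

Section SubAlgebra.
Variables (E : effectAlg) (B : subEffectAlg E).
Implicit Types x y z : sub_effectAlg B.

Lemma sub_oplusP x y z :
  oplus x y = Some z <-> oplus (sval x) (sval y) = Some (sval z).
Proof.
rewrite -[oplus (sval x) _](sub_oplusE (Q := B)).
by split=> [e|e]; [rewrite [sub_oplus x y]e|apply: sub_omap_inj; rewrite e].
Qed.

Lemma sub_leP x y : ea_le x y <-> ea_le (sval x) (sval y).
Proof.
split=> [[z /sub_oplusP e]|[z e]]; first by exists (sval z).
have Bz := sub_diffl e (svalP x) (svalP y).
by exists (exist _ z Bz); apply/sub_oplusP.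
Qed.

Lemma omap_oadd (a b : option (sub_effectAlg B)) :
  omap sval (oadd a b) = oadd (omap sval a) (omap sval b).
Proof. by case: a b => [x|] [y|] //; rewrite !oaddE -sub_oplusE. Qed.

Lemma omap_osum (I : finType) (P : pred I) (f : I -> sub_effectAlg B) :
  omap sval (osum P f) = osum P (fun i => sval (f i)).
Proof. exact: (big_morph _ omap_oadd). Qed.

Lemma riesz_sub_internally_compatible :
  riesz_decomposition (sub_effectAlg B) -> internally_compatible (sub_set B).
Proof.
move=> rB J F BF.
have [//|I [f [[_ f1] cf]]] := @riesz_internally_compatible _ rB J
  (fun j => exist _ (F j) (BF j)).
exists I, (fun i => sval (f i)); split=> [|j].
  by split=> [i|]; [apply: svalP|rewrite -omap_osum f1].
by have [P eP] := cf j; exists P; rewrite -omap_osum eP.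
Qed.

End SubAlgebra.

(** * Blocks as maximal internally compatible sets *)

Lemma maximal_internally_compatible_sub (E : effectAlg) (hE : homogeneous E)
    (M : set E) : maximal_internally_compatible M ->
  exists2 B : subEffectAlg E, sub_set B = M &
    riesz_decomposition (sub_effectAlg B).
Proof.
move=> maxM.
have Md x y z : oplus x y = Some z -> M x -> M z -> M y.
  by move=> e Mx Mz; apply: maximal_diffl maxM Mx Mz e.
have Mp x y z : oplus x y = Some z -> M x -> M y -> M z.
  by move=> e Mx My; apply: maximal_oplus maxM Mx My e.
have Md' x y z : oplus x y = Some z -> M y -> M z -> M x.
  by move=> e; apply: Md; rewrite oplusC; exact: e.
pose B := SubEffectAlg (maximal1 hE maxM) Mp Md Md'; exists B => //.
move=> u v1 v2 v /sub_oplusP e /sub_leP le.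
have [u1 [u2 [[M1 M2] l1 l2 eu]]] :=
  maximal_riesz hE maxM (svalP u) (svalP v1) (svalP v2) e le.
pose x1 : sub_effectAlg B := exist _ u1 M1.
pose x2 : sub_effectAlg B := exist _ u2 M2.
by exists x1, x2; split; [apply/sub_leP|apply/sub_leP|apply/sub_oplusP].
Qed.

Lemma maximal_block (E : effectAlg) (B : subEffectAlg E) :
  maximal_internally_compatible (sub_set B) ->
  riesz_decomposition (sub_effectAlg B) -> block B.
Proof.
move=> [_ maxB] rB; split=> // C rC BC; apply/seteqP; split=> //.
exact: maxB (riesz_sub_internally_compatible rC).
Qed.

(** A block extends to a maximal [M], itself a sub-effect algebra with Riesz decomposition, hence
    equal to the block. *)
Lemma block_maximal (E : effectAlg) (hE : homogeneous E) (B : subEffectAlg E) :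
  block B -> maximal_internally_compatible (sub_set B).
Proof.
move=> [rB maxB].
have [M BM maxM] := maximal_internally_compatible_exists
  (riesz_sub_internally_compatible rB).
have [C CM rC] := maximal_internally_compatible_sub hE maxM.
by rewrite -(maxB C rC) CM.
Qed.

(** * Lattice operations under Riesz decomposition *)

(** Write [t = t1 (+) t2] with [t1 <= a] and [m = t2 (+) m2]. Cancelling [t2] in [t <= v] gives
    [t1 <= b (+) m2]; the part of [t1] below [b] vanishes, so [t1 <= m2]. *)
Lemma riesz_meet (E : effectAlg) (rE : riesz_decomposition E) (a b m u v t : E) :
  (forall s, ea_le s a -> ea_le s b -> s = ea0) ->
  oplus a m = Some u -> oplus b m = Some v ->
  ea_le t u -> ea_le t v -> ea_le t m.
Proof.
move=> ab0 eu ev ltu ltv.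
have [t1 [t2 [l1 [m2 em] et]]] := rE _ _ _ _ eu ltu.
have {ev} ev : oplus m b = Some v by rewrite oplusC.
have [q eq eqv] := oplus_assoc em ev.
have e21 : oplus t2 t1 = Some t by rewrite oplusC.
have l1q : ea_le t1 q by apply: le_oplus2l e21 eqv ltv.
rewrite oplusC in eq.
have [s [r [lsb [m3 em3] es]]] := rE _ _ _ _ eq l1q.
have s0 : s = ea0 by apply: ab0 lsb; apply: le_trans l1; apply: le_oplusl es.
move: es; rewrite s0 oplus0x => -[?]; subst r.
have em' : oplus m2 t2 = Some m by rewrite oplusC.
have em3' : oplus m3 t1 = Some m2 by rewrite oplusC.
have [t' et' em4] := oplus_assoc em3' em'.
by move: et'; rewrite et => -[?]; subst t'; exists m3; rewrite oplusC.
Qed.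

Lemma riesz_has_meet (E : effectAlg) (rE : riesz_decomposition E) :
  (forall a b, ea_le a (orth b) -> exists w : E, lower_bound2 a b w /\
    forall t, lower_bound2 a b t -> ea_le w t -> t = w) ->
  forall u v : E, exists m, lower_bound2 u v m /\
    forall t, lower_bound2 u v t -> ea_le t m.
Proof.
move=> maxE u v.
(* Decomposing [v <= u (+) u'] gives [c <= u] and [b <= u'], whence [a <= u <= b']. *)
have [c [b [[a eu] lb ev]]] := rE _ _ _ _ (oplus_orth u) (le1 v).
have [w [[[a1 ea] [b1 eb]] wmax]] : exists w : E, lower_bound2 a b w /\
    forall t, lower_bound2 a b t -> ea_le w t -> t = w.
  by apply: maxE; apply: le_trans (le_oplusr eu) _; apply: le_orthC.
rewrite oplusC in eu; rewrite oplusC in ev.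
rewrite oplusC in ea; rewrite oplusC in eb.
have [m em emu] := oplus_assoc ea eu.
have [m' em' emv] := oplus_assoc eb ev.
move: em'; rewrite em => -[?]; subst m'.
exists m; split; first by split; [apply: le_oplusr emu|apply: le_oplusr emv].
(* If [s] lies below both remainders [a1] and [b1], then [s (+) w] is a lower bound of [a] and [b],
   so it equals [w] and [s = 0]. *)
move=> t [ltu ltv]; apply: (riesz_meet rE _ emu emv ltu ltv) => s [k ek] [l el].
rewrite oplusC in ek; rewrite oplusC in el.
have [r er era] := oplus_assoc ek ea.
have [r' er' erb] := oplus_assoc el eb.
move: er'; rewrite er => -[?]; subst r'.
have rw : r = w.
  by apply: wmax (le_oplusr er); split; [apply: le_oplusr era|apply: le_oplusr erb].
by subst r; rewrite oplusC in er; apply: oplusI er (oplusx0 w).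
Qed.

(** Joins are dual to meets under the order-reversing involution [orth]. *)
Lemma lattice_ordered_meets (E : effectAlg) :
  (forall u v : E, exists m, lower_bound2 u v m /\
    forall t, lower_bound2 u v t -> ea_le t m) -> lattice_ordered E.
Proof.
move=> meets u v; split; first exact: meets.
have [m [[mu mv] mP]] := meets (orth u) (orth v).
exists (orth m); split; first by split; apply: le_orthC.
move=> t [ut vt]; rewrite -[t]orthK; apply/le_orth2/mP.
by split; apply: le_orth2.
Qed.

(** * Covering by blocks that are MV-algebras *)

Unset Implicit Arguments.

Theorem corollary3p13 (E : effectAlg) (hE : homogeneous E)
    (mE : maximality_property E) :
  \bigcup_(B in [set B : subEffectAlg E | block B]) sub_set B = [set: E] /\
  (forall B : subEffectAlg E, block B -> MV_effect_algebra (sub_effectAlg B)).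
Proof.
split=> [|B bB].
  apply/seteqP; split=> // x _.
  have [M QM maxM] :=
    maximal_internally_compatible_exists (@internally_compatible_pair E x).
  have [B BM rB] := maximal_internally_compatible_sub hE maxM.
  exists B; last by rewrite BM; apply: QM; left.
  by apply: maximal_block rB; rewrite BM.
have sB := maximal_small_closed hE (block_maximal hE bB).
have [rB _] := bB; split=> //; apply/lattice_ordered_meets/(riesz_has_meet rB).
move=> a b /sub_leP /= lab.
have [w [[wa wb] wmax]] := mE (sval a) (sval b).
(* The bound [w] is taken in [E]; [w <= a <= b' <= w'] puts it in the block by small closedness. *)
have Bw : sub_set B w.
  have [z ez] := wa.
  by have [] := sB _ _ _ (svalP a) ez (le_trans lab (le_orth2 wb)).
exists (exist _ w Bw); split; first by split; apply/sub_leP.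
move=> t [/sub_leP ta /sub_leP tb] /sub_leP wt.
exact/sub_val_inj/wmax.
Qed.
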